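(* Let $\mathcal{H}$ be a countably generated Hilbert $\mathcal{A}$-module over a unital $C^*$-algebra $\mathcal{A}$, and let $\{f_k\}_{k=1}^{\infty}$ be a compact-tight frame for $\mathcal{H}$ with frame operator $S$. Then its canonical dual $\{S^{-1}f_k\}_{k=1}^{\infty}$ is a compact-tight frame for $\mathcal{H}$.
   Context: Hilbert $\mathcal{A}$-modules are left modules with an $\mathcal{A}$-valued inner product $\langle\cdot,\cdot\rangle$ that is $\mathcal{A}$-linear in the first variable and satisfies $\langle x,y\rangle=\langle y,x\rangle^*$; the norm is $\|x\|=\|\langle x,x\rangle\|^{1/2}$. Inequalities between elements of $\mathcal{A}$ are in the order of self-adjoint elements of $\mathcal{A}$, and series are understood to converge in norm. A sequence $\{f_k\}_{k=1}^\infty$ in $\mathcal{H}$ is a frame if there are $A,B>0$ with $A\langle f,f\rangle\le\sum_{k}\langle f,f_k\rangle\langle f_k,f\rangle\le B\langle f,f\rangle$ for all $f\in\mathcal{H}$; its frame operator $Sf=\sum_k\langle f,f_k\rangle f_k$ is positive, self-adjoint and invertible. Compact operators on $\mathcal{H}$ are the elements of the norm closure of the linear span of the operators $f\mapsto\langle f,x\rangle y$, $x,y\in\mathcal{H}$. A frame is compact-tight if its frame operator has the form $\mathcal{K}+\xi I$ with $\mathcal{K}$ a compact operator and $\xi$ a real scalar; $I$ is the identity operator. *)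

(* Defs.v *)
From HB Require Import structures.
From mathcomp Require Import all_boot all_order all_algebra complex.
From mathcomp Require Import all_classical all_reals all_analysis.

Set Implicit Arguments.
Unset Strict Implicit.
Unset Printing Implicit Defensive.

Import Order.TTheory GRing.Theory Num.Theory.
Import numFieldNormedType.Exports.

Local Open Scope classical_set_scope.
Local Open Scope ring_scope.

(* The norms of A and H are plain R-valued functions: Hierarchy Builder        *)
(* rejects a new structure inheriting both from rings and from normed types    *)
(* (numDomainType is already their join).                                      *)
Section NormConvergence.
Context {R : realType} {V : zmodType}.
Variable N : V -> R.

Definition norm_cvg (u : nat -> V) (l : V) : Prop :=
  (fun n => N (u n - l)) @ \oo --> (0 : R).

Definition norm_cauchy (u : nat -> V) : Prop :=
  forall e : R, 0 < e -> exists n0 : nat, forall m n : nat,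
    (n0 <= m)%N -> (n0 <= n)%N -> N (u m - u n) < e.

Definition norm_complete : Prop :=
  forall u, norm_cauchy u -> exists l, norm_cvg u l.

Definition norm_closure (E : set V) : set V :=
  [set x | forall e : R, 0 < e -> exists2 y, E y & N (x - y) < e].

End NormConvergence.

(* Unital C*-algebras over the complex numbers R[i]; 1 != 0 comes from algType.*)
HB.mixin Record Algebra_isCStarAlgebra (R : realType) A
    & GRing.Algebra R[i] A := {
  star : A -> A ;
  starK : involutive star ;
  starD : forall a b : A, star (a + b) = star a + star b ;
  starZ : forall (c : R[i]) (a : A), star (c *: a) = conjc c *: star a ;
  starM : forall a b : A, star (a * b) = star b * star a ;
  cnorm : A -> R ;
  cnorm_eq0 : forall a : A, cnorm a = 0 -> a = 0 ;
  cnormD : forall a b : A, cnorm (a + b) <= cnorm a + cnorm b ;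
  cnormZ : forall (c : R[i]) (a : A), cnorm (c *: a) = Normc.normc c * cnorm a ;
  cnormM : forall a b : A, cnorm (a * b) <= cnorm a * cnorm b ;
  cnorm_star : forall a : A, cnorm (star a * a) = cnorm a ^+ 2 ;
  cnorm_complete : norm_complete cnorm
}.

#[short(type="cstarAlgType")]
HB.structure Definition CStarAlgebra (R : realType) :=
  {A of GRing.Algebra R[i] A & Algebra_isCStarAlgebra R A}.

Section Order.
Context {R : realType} {A : cstarAlgType R}.
Implicit Types a b : A.

Definition spectrum a : set R[i] :=
  [set l | ~ exists b, (l%:A - a) * b = 1 /\ b * (l%:A - a) = 1].

(* In R[i], 0 <= l means that l is real and nonnegative. *)
Definition cstar_pos a : Prop :=
  star a = a /\ forall l, spectrum a l -> 0 <= l.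

Definition cstar_le a b : Prop := cstar_pos (b - a).

End Order.

(* The complex scalar c acts on an A-module through c%:A.                      *)
HB.mixin Record Lmodule_isHilbertModule (R : realType) (A : cstarAlgType R) H
    & GRing.Lmodule A H := {
  inner : H -> H -> A ;
  innerDl : forall x y z : H, inner (x + y) z = inner x z + inner y z ;
  innerZl : forall (a : A) (x y : H), inner (a *: x) y = a * inner x y ;
  inner_star : forall x y : H, inner x y = star (inner y x) ;
  inner_pos : forall x : H, cstar_pos (inner x x) ;
  inner_eq0 : forall x : H, inner x x = 0 -> x = 0 ;
  inner_complete : norm_complete (fun x : H => Num.sqrt (cnorm (inner x x)))
}.

#[short(type="hilbertModType")]
HB.structure Definition HilbertModule (R : realType) (A : cstarAlgType R) :=
  {H of GRing.Lmodule A H & Lmodule_isHilbertModule R A H}.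

Section Frames.
Context {R : realType} {A : cstarAlgType R} {H : hilbertModType A}.
Implicit Types (f : nat -> H) (S : H -> H).

Definition hnorm (x : H) : R := Num.sqrt (cnorm (inner x x)).

Definition countably_generated : Prop :=
  exists g : nat -> H,
    norm_closure hnorm
      [set x | exists n (a : 'I_n -> A), x = \sum_(i < n) a i *: g i] = setT.

Definition rank_one (x y : H) : H -> H := fun z => inner z x *: y.

Definition finite_rank (F : H -> H) : Prop :=
  exists n (c : 'I_n -> R[i]) (x y : 'I_n -> H),
    forall z, F z = \sum_(i < n) ((c i)%:A : A) *: rank_one (x i) (y i) z.

(* Closure in the operator norm; boundedness of K is a consequence.            *)
Definition compact_operator (K : {linear H -> H}) : Prop :=
  forall e : R, 0 < e ->
    exists2 F, finite_rank F & forall z, hnorm (K z - F z) <= e * hnorm z.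

Definition is_frame f : Prop :=
  exists a b : R, [/\ 0 < a, 0 < b &
    forall x, exists s : A,
      [/\ norm_cvg cnorm (series (fun k => inner x (f k) * inner (f k) x)) s,
          cstar_le (a%:C%C *: inner x x) s &
          cstar_le s (b%:C%C *: inner x x)]].

Definition is_frame_operator f S : Prop :=
  forall x, norm_cvg hnorm (series (fun k => inner x (f k) *: f k)) (S x).

Definition compact_tight_frame f : Prop :=
  is_frame f /\
  exists S, is_frame_operator f S /\
    exists (K : {linear H -> H}) (xi : R),
      compact_operator K /\ forall x, S x = K x + (xi%:C%C%:A : A) *: x.

(* A choice-based inverse: S^-1 when S is bijective, as frame operators are.   *)
Definition op_inv S : H -> H := 'pinv_(fun=> 0) [set: H] S.

Definition canonical_dual S f : nat -> H := fun k => op_inv S (f k).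

End Frames.

Arguments countably_generated {R A} H.

(* Main.v *)
Require Import Defs.
From HB Require Import structures.
From mathcomp Require Import all_boot all_order all_algebra.
From mathcomp Require Import all_classical all_reals all_analysis.
From mathcomp Require Import complex ring lra.

(* If S = K + xi I and T = S^-1, then T - xi^-1 I = - xi^-1 T K when xi <> 0,
   and when xi = 0 the identity T K is compact, so that T is compact too; T is
   the frame operator of the canonical dual.  The bounds
   a<x,x> <= <Sx,x> <= b<x,x> give a S <= S^2 <= b S by expanding
   <Sx - ax, Sx - ax> >= 0 and <S(bx - Sx), bx - Sx> >= 0; hence 1 - b^-1 S is a
   strict contraction, S is invertible, and the frame bounds of the dual follow,
   without square roots.

   The order on A is accessible without functional calculus or complex analysis
   once a self-adjoint b has ||b|| or -||b|| in its spectrum.  If ||b|| = 1 and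
   1 - b^2 were invertible, the sums of b^(2k) over k < 2^m, which are
   (1 - b^(2^(m+1))) (1 - b^2)^-1, would be bounded; but such a sum factors as
   the product of the 1 + b^(2^(j+1)) for j < m, and
   ||x (1 + c^2)|| >= 2 ||x c|| for commuting self-adjoint x, c bounds its norm
   below by 2^m. *)

Set Implicit Arguments.
Unset Strict Implicit.
Unset Printing Implicit Defensive.

Import Order.TTheory GRing.Theory Num.Theory.
Import numFieldNormedType.Exports.

Local Open Scope classical_set_scope.
Local Open Scope ring_scope.

(** * Limits and contractions in a normed abelian group *)

Section ZmodNorm.
Context {R : realType} {V : zmodType}.
Variable N : V -> R.
Hypothesis ND : forall x y, N (x + y) <= N x + N y.
Hypothesis NN : forall x, N (- x) = N x.
Hypothesis N0 : N 0 = 0.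
Hypothesis N_eq0 : forall x, N x = 0 -> x = 0.

Lemma norm_ge0 x : 0 <= N x.
Proof. by have := ND x (- x); rewrite subrr N0 NN; lra. Qed.

Lemma norm_cvgP u l : norm_cvg N u l <->
  (forall e, 0 < e -> exists n0, forall n, (n0 <= n)%N -> N (u n - l) < e).
Proof.
split=> [/cvgrPdist_lt cu e /cu [n0 _ un0]|cu].
  exists n0 => n /un0 /=.
  by rewrite sub0r normrN ger0_norm ?norm_ge0.
apply/cvgrPdist_lt => e /cu [n0 un0]; exists n0 => // n /= /un0.
by rewrite sub0r normrN ger0_norm ?norm_ge0.
Qed.

Lemma norm_limit_unique u l l' : norm_cvg N u l -> norm_cvg N u l' -> l = l'.
Proof.
move=> /norm_cvgP cl /norm_cvgP cl'; apply/subr0_eq/N_eq0/eqP.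
rewrite eq_le norm_ge0 andbT; apply/ler_addgt0Pr => e e0; rewrite add0r.
have e20 : 0 < e / 2 by lra.
have [n nl] := cl _ e20; have [m ml] := cl' _ e20.
have := nl (maxn n m) (leq_maxl _ _); have := ml (maxn n m) (leq_maxr _ _).
set w := u _ => h1 h2.
have -> : l - l' = (w - l') + - (w - l) by rewrite opprB [RHS]addrC subrKA.
by have := ND (w - l') (- (w - l)); rewrite NN; lra.
Qed.

(** The iterates of [y + phi x] from 0 are the partial sums of the Neumann series. Only subtraction
    is involved, so the result serves both the algebra and the module. *)
Lemma contraction_subr_surj (phi : V -> V) (q : R) (y : V) :
    norm_complete N -> {morph phi : x y / x - y} -> q < 1 ->
    (forall x, N (phi x) <= q * N x) ->
  exists x, x - phi x = y.
Proof.
move=> N_complete phiB q1 phiq.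
(* Raising [q] to at least 1/2 keeps it below 1 and makes multiplication by it monotone. *)
wlog q0 : q q1 phiq / 0 < q.
  move=> wl; apply: (wl (Num.max q (1 / 2))).
  - by rewrite gt_max q1; lra.
  - move=> x; apply: (le_trans (phiq x)); rewrite ler_wpM2r ?norm_ge0 ?le_max ?lexx//.
  - by rewrite lt_max; apply/orP; right; lra.
pose u n := iter n (fun x => y + phi x) 0.
have uS n : u n.+1 = y + phi (u n) by [].
(* The bound is the fixed point of [t |-> N y + q * t]. *)
have bound k : N (u k) <= N y / (1 - q).
  elim: k => [|k IH].
    by rewrite /u /= N0 divr_ge0 ?norm_ge0//; lra.
  rewrite uS; apply: (le_trans (ND _ _)).
  have -> : N y / (1 - q) = N y + q * (N y / (1 - q)) by field; lra.
  by rewrite lerD2l (le_trans (phiq _))// ler_wpM2l// ltW.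
have step n k : N (u (n + k)%N - u n) <= q ^+ n * (N y / (1 - q)).
  elim: n => [|n IH]; first by rewrite add0n subr0 expr0 mul1r.
  rewrite addSn !uS opprD addrACA subrr add0r -phiB.
  by rewrite (le_trans (phiq _))// exprS -mulrA ler_wpM2l// ltW.
have small e : 0 < e -> exists n0, forall n, (n0 <= n)%N ->
    q ^+ n * (N y / (1 - q)) < e.
  move=> e0.
  have /cvgrPdist_lt/(_ _ e0) [n0 _ H] :
      (fun n => q ^+ n * (N y / (1 - q))) @ \oo --> (0 : R).
    rewrite -[0](mul0r (N y / (1 - q))).
    by apply: cvgMl; apply: cvg_expr; rewrite gtr0_norm.
  exists n0 => n /H /=; rewrite sub0r normrN ger0_norm//.
  by rewrite mulr_ge0 ?exprn_ge0 ?(ltW q0) ?divr_ge0 ?norm_ge0// subr_ge0 ltW.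
have [x ux] : exists l, norm_cvg N u l.
  apply: N_complete => e e0.
  have e20 : 0 < e / 2 by lra.
  have [n0 H] := small _ e20; exists n0 => m n hm hn.
  have -> : u m - u n = (u m - u n0) + - (u n - u n0).
    by rewrite opprB subrKA.
  apply: (le_lt_trans (ND _ _)); rewrite NN.
  have := step n0 (m - n0)%N; have := step n0 (n - n0)%N.
  by rewrite !subnKC//; have := H n0 (leqnn _); lra.
exists x; apply/eqP; rewrite subr_eq; apply/eqP.
(* The shifted sequence tends to [x] and also to [y + phi x]. *)
apply: (@norm_limit_unique (fun n => u n.+1)).
  move/norm_cvgP : ux => ux; apply/norm_cvgP => e /ux[n0 H].
  by exists n0 => n nn; apply: H; apply: leqW.
move/norm_cvgP : ux => ux; apply/norm_cvgP => e /ux[n0 H].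
exists n0 => n nn; rewrite uS opprD addrACA subrr add0r -phiB.
apply: (le_lt_trans (phiq _)); apply: le_lt_trans (H _ nn).
by apply: ler_piMl; [exact: norm_ge0 | exact: ltW].
Qed.

End ZmodNorm.

Lemma norm_cvg_map {R : realType} {V W : zmodType} (N : V -> R) (M : W -> R)
    (g : V -> W) (c : R) u l :
  (forall y, 0 <= M y) -> (forall x, M (g x - g l) <= c * N (x - l)) ->
  norm_cvg N u l -> norm_cvg M (g \o u) (g l).
Proof.
move=> M0 gc ul; apply: (@squeeze_cvgr _ _ _ _ (fun=> 0) (fun n => c * N (u n - l))).
- by apply: nearW => n; rewrite M0 gc.
- exact: cvg_cst.
- by rewrite -[0](mulr0 c); apply: cvgMr.
Qed.

Lemma normc_real {R : rcfType} (r : R) : Normc.normc r%:C%C = `|r|.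
Proof. by rewrite /= expr0n /= addr0 sqrtr_sqr. Qed.

Lemma conjc_i {R : rcfType} : conjc 'i%C = - 'i%C :> R[i].
Proof. by rewrite /GRing.opp /= oppr0. Qed.

Lemma mulc_ii {R : rcfType} : 'i%C * 'i%C = -1 :> R[i].
Proof. by rewrite -expr2 sqr_i. Qed.

(** * Involution and norm of a unital C*-algebra *)

Section CStar.
Context {R : realType} {A : cstarAlgType R}.
Implicit Types (a b x y : A) (l c : R[i]) (r : R).

Lemma star0 : star (0 : A) = 0.
Proof. by apply: (addrI (star (0 : A))); rewrite -starD !addr0. Qed.

Lemma starN a : star (- a) = - star a.
Proof. by apply: (addrI (star a)); rewrite -starD !subrr star0. Qed.

Lemma starB a b : star (a - b) = star a - star b.
Proof. by rewrite starD starN. Qed.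

Lemma star1 : star (1 : A) = 1.
Proof. by rewrite -[LHS]mulr1 -{2}(starK 1) -starM mulr1 starK. Qed.

Lemma starX a n : star (a ^+ n) = star a ^+ n.
Proof. by elim: n => [|n IH]; rewrite ?star1// exprS exprSr starM IH. Qed.

Lemma starZr r a : star (r%:C%C *: a) = r%:C%C *: star a.
Proof. by rewrite starZ conjc_real. Qed.

Lemma star_sum (I : Type) (s : seq I) (F : I -> A) :
  star (\sum_(i <- s) F i) = \sum_(i <- s) star (F i).
Proof. exact: (big_morph _ starD star0). Qed.

Lemma cnorm0 : cnorm (0 : A) = 0.
Proof. by rewrite -(scale0r (0 : A)) cnormZ Normc.normc0 mul0r. Qed.

Lemma cnormN a : cnorm (- a) = cnorm a.
Proof. by rewrite -scaleN1r cnormZ normcN Normc.normc1 mul1r. Qed.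

Lemma cnorm_ge0 a : 0 <= cnorm a.
Proof. exact: (norm_ge0 cnormD cnormN cnorm0). Qed.

Lemma cnormZr r a : cnorm (r%:C%C *: a) = `|r| * cnorm a.
Proof. by rewrite cnormZ normc_real. Qed.

(** The C*-identity and submultiplicativity give [cnorm b ^+ 2 <= cnorm (star b) * cnorm b]; cancel
    a factor, then take [b] to be [a] and [star a]. *)
Lemma cnorm_starE a : cnorm (star a) = cnorm a.
Proof.
have le b : cnorm b <= cnorm (star b).
  have [->|b0] := eqVneq (cnorm b) 0; first exact: cnorm_ge0.
  have bp : 0 < cnorm b by rewrite lt_neqAle eq_sym b0 cnorm_ge0.
  by rewrite -(ler_pM2r bp) -expr2 -cnorm_star cnormM.
by apply/eqP; rewrite eq_le le andbT -{2}(starK a) le.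
Qed.

Lemma cnorm1 : cnorm (1 : A) = 1.
Proof.
have := cnorm_star (1 : A); rewrite star1 mulr1 expr2 => h.
have n0 : cnorm (1 : A) != 0.
  by apply/eqP => /cnorm_eq0/eqP; rewrite oner_eq0.
by apply: (mulIf n0); rewrite mul1r -h.
Qed.

Lemma cnorm_sqr a : star a = a -> cnorm (a ^+ 2) = cnorm a ^+ 2.
Proof. by move=> sa; rewrite -cnorm_star sa expr2. Qed.

(** * Invertibility and the spectrum *)

Definition invertible a := exists b, a * b = 1 /\ b * a = 1.

Lemma invertibleM a b : invertible a -> invertible b -> invertible (a * b).
Proof.
move=> [a' [aa a'a]] [b' [bb b'b]]; exists (b' * a'); split.
  by rewrite -mulrA [b * _]mulrA bb mul1r.
by rewrite -mulrA [a' * _]mulrA a'a mul1r.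
Qed.

Lemma invertibleN a : invertible a -> invertible (- a).
Proof. by move=> [b [ab ba]]; exists (- b); rewrite !mulrNN. Qed.

Lemma invertibleZ c a : c != 0 -> invertible a -> invertible (c *: a).
Proof.
move=> c0 [b [ab ba]]; exists (c^-1 *: b).
by rewrite -!scalerAr -!scalerAl !scalerA ab ba divff// mulVf// scale1r.
Qed.

Lemma spectrumE a l : ~ spectrum a l <-> invertible (l%:A - a).
Proof. by split => [/contrapT|h /(_ h)]. Qed.

(** Neumann series for left and for right multiplication by [a] yield a right and a left inverse,
    which must coincide. *)
Lemma invertible_sub1 a : cnorm a < 1 -> invertible (1 - a).
Proof.
move=> a1.
have solve := contraction_subr_surj cnormD cnormN cnorm0 cnorm_eq0 1
  cnorm_complete _ a1.
have [b hb] : exists b, b - a * b = 1.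
  by apply: (solve (fun x => a * x)) => x; [move=> y; exact: mulrBr|exact: cnormM].
have [b' hb'] : exists b, b - b * a = 1.
  apply: (solve (fun x => x * a)) => x; first by move=> y; exact: mulrBl.
  by rewrite mulrC cnormM.
have h1 : (1 - a) * b = 1 by rewrite mulrBl mul1r.
have h2 : b' * (1 - a) = 1 by rewrite mulrBr mulr1.
exists b; split => //.
by have <- : b' = b by rewrite -[LHS]mulr1 -h1 mulrA h2 mul1r.
Qed.

(** If [l] exceeds the norm of [a] in modulus, then [l - a = l (1 - l^-1 a)] is invertible. *)
Lemma spectrum_norm a l : spectrum a l -> Normc.normc l <= cnorm a.
Proof.
apply: contraPP => /negP; rewrite -ltNge => la; apply/spectrumE.
have l0 : l != 0.
  by apply: contraTneq la => ->; rewrite Normc.normc0 -leNgt cnorm_ge0.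
have -> : l%:A - a = l *: (1 - l^-1 *: a).
  by rewrite scalerBr scalerA divff// scale1r.
apply: invertibleZ => //; apply: invertible_sub1.
rewrite cnormZ Normc.normcV -ltr_pdivlMl ?invr_gt0 ?invrK ?mulr1//.
exact: le_lt_trans (cnorm_ge0 _) la.
Qed.

Lemma spectrum_shift c a l : spectrum (c%:A + a) l <-> spectrum a (l - c).
Proof. by rewrite /spectrum /= scalerBl opprD addrA. Qed.

Lemma spectrum_sub c a l : spectrum (c%:A - a) l <-> spectrum a (c - l).
Proof.
have e : (c - l)%:A - a = - (l%:A - (c%:A - a)).
  by rewrite !opprB scalerBl addrAC.
split; apply: contra_not => /invertibleN; rewrite ?e; first by rewrite opprK.
by rewrite -e => h; apply/h.
Qed.

(* Arens: test [a + i s] for all real [s]. *)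
Lemma spectrum_real a l : star a = a -> spectrum a l -> exists r, l = r%:C%C.
Proof.
case: l => p q sa al; exists p; congr (Complex _ _).
(* From [p^2 + (q + s)^2 <= ||s^2 + a^2|| <= s^2 + ||a||^2], where [s^2] cancels. *)
have key s : p ^+ 2 + q ^+ 2 + 2 * q * s <= cnorm a ^+ 2.
  have : spectrum ((s *i)%C%:A + a) (Complex p (q + s)).
    apply/spectrum_shift; rewrite (_ : _ - _ = Complex p q)//.
    by apply/eqP; rewrite eq_complex /= subr0 addrK !eqxx.
  move=> /spectrum_norm.
  have -> : cnorm ((s *i)%C%:A + a) = Num.sqrt (cnorm ((s ^+ 2)%:C%C%:A + a ^+ 2)).
    rewrite -[LHS]ger0_norm ?cnorm_ge0// -sqrtr_sqr -cnorm_star.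
    rewrite starD starZ star1 sa; congr (Num.sqrt (cnorm _)).
    have -> : conjc (s *i)%C = - (s *i)%C by rewrite /GRing.opp /= oppr0.
    rewrite mulrDl !mulrDr -!scalerAl !mul1r -scalerAr mulr1 scalerA.
    rewrite scaleNr addrA addrNK expr2; congr (_%:A + _).
    by apply/eqP; rewrite eq_complex /=; apply/andP; split; apply/eqP; ring.
  rewrite [Normc.normc _]/= ler_sqrt ?cnorm_ge0// => /le_trans/(_ (cnormD _ _)).
  rewrite cnormZr cnorm1 mulr1 cnorm_sqr// ger0_norm ?sqr_ge0//.
  by move: (cnorm a) => n; lra.
have [//|q0] := eqVneq q 0.
(* The bound is affine in [s]; this [s] makes [2 q s] equal to [n^2 + 1], which is too large. *)
move: (cnorm a) key => n /(_ ((n ^+ 2 + 1) / (2 * q))).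
rewrite [2 * q * _]mulrC divfK ?mulf_neq0//.
by have := sqr_ge0 p; have := sqr_ge0 q; lra.
Qed.

(** * The norm of a self-adjoint element, up to sign, as a spectral value *)

(** With [z = x + i y], commutation gives [star z * z = x^2 + y^2], while [2 x = z + star z] gives
    [||x|| <= ||z||]. *)
Lemma cnorm_le_sqrD x y : star x = x -> star y = y -> GRing.comm x y ->
  cnorm x ^+ 2 <= cnorm (x ^+ 2 + y ^+ 2).
Proof.
move=> sx sy xy; pose z := x + 'i%C *: y.
have zE : star z = x - 'i%C *: y by rewrite starD starZ sx sy conjc_i scaleNr.
have -> : x ^+ 2 + y ^+ 2 = star z * z.
  rewrite zE mulrBl !mulrDr -!scalerAl -!scalerAr xy scalerA mulc_ii scaleN1r.
  by rewrite opprB addrACA subrr addr0 !expr2.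
rewrite cnorm_star ler_pXn2r ?nnegrE ?cnorm_ge0//.
have : cnorm (z + star z) = 2 * cnorm x.
  rewrite zE addrACA subrr addr0 -mulr2n -scaler_nat.
  by rewrite cnormZ -(normr_nat R 2) -normc_real rmorph_nat.
by have := cnormD z (star z); rewrite cnorm_starE; lra.
Qed.

(** By the identity [(x + x b^2)^2 = (2 x b)^2 + (x - x b^2)^2] and the bound for sums of two
    commuting squares. *)
Lemma cnorm_mul1D_sqr x b : star x = x -> star b = b -> GRing.comm x b ->
  2 * cnorm (x * b) <= cnorm (x * (1 + b ^+ 2)).
Proof.
move=> sx sb xb.
rewrite -(@ler_pXn2r _ 2) ?nnegrE ?mulr_ge0 ?cnorm_ge0//.
have xb2 : GRing.comm x (b ^+ 2) by exact: commrX.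
have su : star (x * b ^+ 2) = x * b ^+ 2 by rewrite starM starX sx sb.
have s2 : star ((2 : R)%:C%C *: (x * b)) = (2 : R)%:C%C *: (x * b).
  by rewrite starZr starM sx sb xb.
have sB : star (x - x * b ^+ 2) = x - x * b ^+ 2 by rewrite starB sx su.
have cxu : GRing.comm x (x * b ^+ 2) by apply: commrM.
have cu : GRing.comm ((2 : R)%:C%C *: (x * b)) (x - x * b ^+ 2).
  have cxb : GRing.comm (x * b) x by apply: commr_sym; apply: commrM.
  have cxbb : GRing.comm (x * b) b.
    by apply: commr_sym; apply: commrM => //; exact: commr_sym.
  rewrite /GRing.comm -scalerAl -scalerAr; congr (_ *: _).
  by apply: commrB => //; apply: commrM => //; apply: commrX.
rewrite mulrDr mulr1 -cnorm_sqr ?starD ?sx ?su//.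
have -> : 2 * cnorm (x * b) = cnorm ((2 : R)%:C%C *: (x * b)).
  by rewrite cnormZr normr_nat.
apply: le_trans (cnorm_le_sqrD s2 sB cu) _; rewrite le_eqVlt; apply/orP; left.
apply/eqP; congr cnorm; rewrite !expr2 mulrBl !mulrDl !mulrDr -scalerAl -scalerAr scalerA.
have xxbb : x * (x * (b * b)) = x * b * (x * b).
  by rewrite -!mulrA [b * (x * b)]mulrA -xb -!mulrA.
have xbbx : x * (b * b) * x = x * b * (x * b).
  by rewrite -mulrA -expr2 -xb2 expr2 xxbb.
rewrite !mulrN xxbb xbbx.
move: (x * b * (x * b)) (x * (b * b) * _) (x * x) => w v u.
have -> : (2 : R)%:C%C * (2 : R)%:C%C = 4%:R by rewrite -rmorphM -natrM rmorph_nat.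
rewrite scaler_nat -[4%N]/(2 + 2)%N mulrnDr mulr2n opprB.
by rewrite (addrACA u) -opprD [LHS]addrC subrKA [w + v]addrC addrACA.
Qed.

(* [dyadic_prod b m] is the sum of the [b ^+ (2 * k)] for [k < 2 ^ m]. *)
Fixpoint dyadic_prod b m :=
  if m is m'.+1 then dyadic_prod b m' * (1 + (b ^+ (2 ^ m')) ^+ 2) else 1.

Lemma comm_dyadic_prod b x m : GRing.comm x b -> GRing.comm x (dyadic_prod b m).
Proof.
move=> xb; elim: m => [|m IH] /=; first exact: commr1.
by apply: commrM => //; apply: commrD; [exact: commr1|do 2!apply: commrX].
Qed.

Lemma star_dyadic_prod b m : star b = b ->
  star (dyadic_prod b m) = dyadic_prod b m.
Proof.
move=> sb; elim: m => [|m IH] /=; first exact: star1.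
rewrite starM IH starD star1 !starX sb; apply: comm_dyadic_prod.
apply: commr_sym; apply: commrD; first exact: commr1.
by rewrite -exprM; apply: commrX.
Qed.

Lemma dyadic_prod_telescope b m :
  dyadic_prod b m * (1 - b ^+ 2) = 1 - b ^+ (2 ^ m.+1).
Proof.
elim: m => [|m IH] /=; first by rewrite mul1r.
have c : GRing.comm (1 + (b ^+ (2 ^ m)) ^+ 2) (1 - b ^+ 2).
  apply: commr_sym; apply: commrD; first exact: commr1.
  apply: commr_sym; rewrite -exprM; apply: commrB; first exact: commr1.
  by apply: commrX; apply: commr_sym; apply: commrX.
rewrite -mulrA c mulrA IH -exprM -expnSr mulrDr mulr1 mulrBl mul1r.
by rewrite addrA subrK -expr2 -exprM -expnSr.
Qed.

(** Peeling off the last factor costs a 2 and leaves [y = b^(2^m)], which is absorbed into [x];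
    hence the induction over all [x]. The exponents add up as [2^m + (2^m - 1) = 2^(m+1) - 1]. *)
Lemma cnorm_dyadic_prod b x m : star x = x -> star b = b -> GRing.comm x b ->
  2 ^+ m * cnorm (x * b ^+ (2 ^ m).-1) <= cnorm (x * dyadic_prod b m).
Proof.
move=> + sb; elim: m x => [|m IH] x sx xb /=.
  by rewrite mul1r.
set y := b ^+ (2 ^ m).
have sy : star y = y by rewrite starX sb.
have cy : GRing.comm x y by apply: commrX.
have yb : GRing.comm y b by apply: commr_sym; apply: commrX.
have cp : GRing.comm (x * dyadic_prod b m) y.
  apply: commr_sym; apply: commrM; first exact: commr_sym.
  exact: comm_dyadic_prod.
have sxp : star (x * dyadic_prod b m) = x * dyadic_prod b m.
  by rewrite starM star_dyadic_prod// sx; apply/commr_sym/comm_dyadic_prod.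
rewrite mulrA; apply: le_trans (cnorm_mul1D_sqr sxp sy cp).
have -> : x * dyadic_prod b m * y = x * y * dyadic_prod b m.
  by rewrite -!mulrA (comm_dyadic_prod _ yb).
have -> : x * b ^+ (2 ^ m.+1).-1 = x * y * b ^+ (2 ^ m).-1.
  rewrite -mulrA -exprD; congr (_ * _ ^+ _).
  by rewrite expnS mul2n -addnn -{2}(prednK (expn_gt0 2 m)) addnS.
rewrite exprS -mulrA ler_pM2l//; apply: IH.
  by rewrite starM sx sy cy.
by apply: commr_sym; apply: commrM; apply: commr_sym.
Qed.

Lemma cnorm_exp2n b m : star b = b -> cnorm (b ^+ (2 ^ m)) = cnorm b ^+ (2 ^ m).
Proof.
move=> sb; elim: m => [|m IH]; first by rewrite expn0 !expr1.
by rewrite expnSr !exprM cnorm_sqr ?IH// starX sb.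
Qed.

Lemma not_invertible_sub1_sqr b : star b = b -> cnorm b = 1 ->
  ~ invertible (1 - b ^+ 2).
Proof.
move=> sb b1 [d [bd db]].
have bound m : 2 ^+ m <= 2 * cnorm d.
  (* One more factor [b], of norm 1, gives [b^(2^m)], whose norm is 1. *)
  have lb : 1 <= cnorm (1 * b ^+ (2 ^ m).-1).
    rewrite mul1r -[1](expr1n _ (2 ^ m)) -b1 -cnorm_exp2n//.
    rewrite -{1}(prednK (_ : 0 < 2 ^ m)%N) ?expn_gt0// exprSr.
    by apply: le_trans (cnormM _ _) _; rewrite b1 mulr1.
  have := cnorm_dyadic_prod m star1 sb (commr_sym (commr1 b)).
  have -> : 1 * dyadic_prod b m = (1 - b ^+ (2 ^ m.+1)) * d.
    by rewrite -dyadic_prod_telescope -mulrA bd mulr1 mul1r.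
  move=> h; apply: le_trans (le_trans _ (le_trans h (cnormM _ _))) _.
    by rewrite -[leLHS]mulr1 ler_wpM2l.
  apply: ler_wpM2r; first exact: cnorm_ge0.
  apply: le_trans (cnormD _ _) _.
  by rewrite cnormN cnorm1 cnorm_exp2n// b1 expr1n.
(* Contradiction: [n + 1 <= 2^(n+1) <= 2 ||d|| < n + 1]. *)
pose n := Num.truncn (2 * cnorm d).
have : (2 * cnorm d) < n.+1%:R by rewrite truncnS_gt// mulr_ge0 ?cnorm_ge0.
apply/negP; rewrite -leNgt; apply: le_trans (bound n.+1).
by rewrite -natrX ler_nat ltnW// ltn_expl.
Qed.

(** After scaling to [u] of norm 1, [1 - u^2 = (1 - u)(1 + u)], and the factors are nonzero
    multiples of [||b|| - b] and [- ||b|| - b]: they cannot both be invertible. *)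
Lemma spectrum_radius b : star b = b ->
  spectrum b (cnorm b)%:C%C \/ spectrum b (- cnorm b)%:C%C.
Proof.
move=> sb; have [b0|b0] := eqVneq (cnorm b) 0.
  left; rewrite b0 (cnorm_eq0 _ b0) /spectrum /= scale0r subrr => -[c [+ _]].
  by rewrite mul0r => /eqP; rewrite eq_sym oner_eq0.
apply: contrapT => /not_orP[/spectrumE i1 /spectrumE i2].
set n : R := cnorm b in b0 i1 i2.
have n0 : 0 < n by rewrite lt_neqAle eq_sym b0 cnorm_ge0.
have nC0 : n%:C%C != 0 by rewrite fmorph_eq0.
have nVC : n%:C%C^-1 = n^-1%:C%C by rewrite fmorphV.
pose u := n^-1%:C%C *: b.
apply: (@not_invertible_sub1_sqr u).
- by rewrite starZr sb.
- by rewrite cnormZr gtr0_norm ?invr_gt0// mulVf.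
have -> : 1 - u ^+ 2 = (1 - u) * (1 + u).
  by rewrite mulrDr mulr1 mulrBl mul1r addrA subrK expr2.
have nu : n%:C%C *: u = b by rewrite scalerA -nVC divff// scale1r.
apply: invertibleM.
  have -> : 1 - u = n%:C%C^-1 *: (n%:C%C%:A - b).
    by rewrite scalerBr scalerA mulVf// scale1r nVC.
  by apply: invertibleZ; rewrite ?invr_eq0.
have -> : 1 + u = (- n%:C%C^-1) *: ((- n)%:C%C%:A - b).
  rewrite scaleNr -scalerN opprB rmorphN scaleNr opprK scalerDr scalerA.
  by rewrite mulVf// scale1r nVC addrC.
by apply: invertibleZ; rewrite ?oppr_eq0 ?invr_eq0.
Qed.

(** * Positivity through norm estimates *)

Lemma ge0_realC r : (0 <= (r%:C%C : R[i])) = (0 <= r).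
Proof. by rewrite lecE /= eqxx. Qed.

(** If [n] is the norm of [r - a], then [r - n] or [r + n] is a spectral value of [a]. The former is
    nonnegative; the latter is at most [||a|| <= r], so [n <= 0]. *)
Lemma pos_cnorm_sub a r : cstar_pos a -> cnorm a <= r ->
  cnorm (r%:C%C%:A - a) <= r.
Proof.
move=> [sa pa] ar; move Dn : (cnorm (_ - a)) => n.
have r0 : 0 <= r := le_trans (cnorm_ge0 a) ar.
have sb : star (r%:C%C%:A - a) = r%:C%C%:A - a by rewrite starB starZr star1 sa.
have [/spectrum_sub|/spectrum_sub] := spectrum_radius sb; rewrite Dn -rmorphB.
  by move=> /pa; rewrite ge0_realC subr_ge0.
move=> /spectrum_norm; rewrite normc_real opprK.
by move: (ler_norm (r + n)) ar r0; move: (cnorm a) => p; lra.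
Qed.

(** A spectral value [s] of [a] is real and satisfies [r - s <= ||r - a|| <= r]. *)
Lemma cnorm_sub_pos a r : star a = a -> cnorm (r%:C%C%:A - a) <= r ->
  cstar_pos a.
Proof.
move=> sa ar; split=> // l al.
have [s ls] := spectrum_real sa al; subst l; rewrite ge0_realC.
have : spectrum (r%:C%C%:A - a) (r - s)%:C%C.
  by apply/spectrum_sub; rewrite -rmorphB subKr.
move=> /spectrum_norm; rewrite normc_real => h.
by have := le_trans (ler_norm _) (le_trans h ar); rewrite gerBl.
Qed.

(** The norm criterion turns this into the triangle inequality, with radius [||a|| + ||b||]. *)
Lemma cstar_posD a b : cstar_pos a -> cstar_pos b -> cstar_pos (a + b).
Proof.
move=> pa pb; apply: (@cnorm_sub_pos _ (cnorm a + cnorm b)).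
  by rewrite starD pa.1 pb.1.
have -> : (cnorm a + cnorm b)%:C%C%:A - (a + b) =
    ((cnorm a)%:C%C%:A - a) + ((cnorm b)%:C%C%:A - b).
  by rewrite rmorphD scalerDl opprD addrACA.
by apply: le_trans (cnormD _ _) _; rewrite lerD ?pos_cnorm_sub.
Qed.

Lemma cstar_posZ r a : 0 <= r -> cstar_pos a -> cstar_pos (r%:C%C *: a).
Proof.
move=> r0 pa; apply: (@cnorm_sub_pos _ (r * cnorm a)).
  by rewrite starZr pa.1.
rewrite rmorphM -scalerA -scalerBr cnormZr ger0_norm//.
by rewrite ler_wpM2l ?pos_cnorm_sub.
Qed.

Lemma cstar_pos_cnorm a : star a = a -> cstar_pos ((cnorm a)%:C%C%:A - a).
Proof.
move=> sa; apply: (@cnorm_sub_pos _ (cnorm a)).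
  by rewrite starB starZr star1 sa.
by rewrite subKr.
Qed.

(** Passes from order bounds to norm bounds: if [||a||] is a spectral value then [r - ||a|| >= 0],
    and if [- ||a||] is one then [a = 0]. *)
Lemma cnorm_le_scalar a r : 0 <= r -> cstar_pos a ->
  cstar_pos (r%:C%C%:A - a) -> cnorm a <= r.
Proof.
move=> r0 [sa pa] [_ ra]; have [al|/pa] := spectrum_radius sa.
  have /ra : spectrum (r%:C%C%:A - a) (r - cnorm a)%:C%C.
    by apply/spectrum_sub; rewrite -rmorphB subKr.
  by rewrite ge0_realC subr_ge0.
by rewrite ge0_realC oppr_ge0 => /le_trans; apply.
Qed.

Lemma cstar_le_trans a b d : cstar_le a b -> cstar_le b d -> cstar_le a d.
Proof. by move=> ab bc; rewrite /cstar_le -(subrKA b); apply: cstar_posD. Qed.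

Lemma cstar_le_cnorm a b : cstar_pos a -> cstar_le a b -> cnorm a <= cnorm b.
Proof.
move=> pa ab; apply: cnorm_le_scalar; rewrite ?cnorm_ge0//.
apply: (cstar_le_trans ab); apply: cstar_pos_cnorm.
by rewrite -(subrK a b) starD pa.1 ab.1.
Qed.

(** For [r < 0] and [m = sqrt (- r)], [r - a^2 = (i m - a)(i m + a)]; both factors are invertible
    because the spectrum of [a] is real. *)
Lemma cstar_pos_sqr a : star a = a -> cstar_pos (a ^+ 2).
Proof.
move=> sa; have sa2 : star (a ^+ 2) = a ^+ 2 by rewrite starX sa.
split=> // l al; have [r lr] := spectrum_real sa2 al; subst l.
rewrite ge0_realC leNgt; apply/negP => r0; apply: al.
set m := Num.sqrt (- r).
have m0 : 0 < m by rewrite sqrtr_gt0; lra.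
have inv (e : R) : e != 0 -> invertible ((e *i)%C%:A - a).
  move=> e0; apply/spectrumE => /(spectrum_real sa) [s [_ /eqP]].
  by rewrite (negPf e0).
have -> : r%:C%C%:A - a ^+ 2 = ((m *i)%C%:A - a) * - ((((- m) *i)%C)%:A - a).
  have -> : ((- m) *i)%C = - (m *i)%C :> R[i] by rewrite {2}/GRing.opp /= oppr0.
  rewrite scaleNr -opprD opprK mulrDr !mulrBl -!scalerAl !mul1r -scalerAr mulr1.
  rewrite scalerA subrKA -expr2; congr (_%:A - _).
  apply/eqP; rewrite eq_complex /= !mulr0 !mul0r addr0 eqxx andbT.
  by rewrite sub0r -expr2 sqr_sqrtr ?opprK// oppr_ge0 ltW.
apply: invertibleM; first by apply: inv; rewrite gt_eqF.
by apply/invertibleN/inv; rewrite oppr_eq0 gt_eqF.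
Qed.

(** If [c] inverts [l - b a], then [l^-1 (1 + a c b)] inverts [l - a b]. *)
Lemma spectrum_mul_comm a b l : l != 0 ->
  spectrum (a * b) l -> spectrum (b * a) l.
Proof.
move=> l0; apply: contra_not => -[c [c1 c2]].
exists (l^-1 *: (1 + a * c * b)).
split.
  rewrite -scalerAr mulrDr mulr1 mulrBl.
  have -> : l%:A * (a * c * b) = a * (l%:A * c) * b.
    by rewrite -!scalerAl !mul1r -scalerAr -scalerAl.
  have -> : a * b * (a * c * b) = a * (b * a * c) * b by rewrite !mulrA.
  rewrite -mulrBl -mulrBr -mulrBl c1 mulr1 subrK.
  by rewrite scalerA mulVf// scale1r.
rewrite -scalerAl mulrDl mul1r mulrBr.
have -> : a * c * b * l%:A = a * (c * l%:A) * b.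
  by rewrite -!scalerAr !mulr1 -scalerAl.
have -> : a * c * b * (a * b) = a * (c * (b * a)) * b by rewrite !mulrA.
rewrite -mulrBl -mulrBr -mulrBr c2 mulr1 subrK.
by rewrite scalerA mulVf// scale1r.
Qed.

(* When -||a* a|| is in the spectrum of [a* a], use that [a a*] is bounded by [r]
   like [a* a] and that [a* a + a a*] is a sum of two squares. *)
Lemma star_mul_le_scalar a r : 0 <= r ->
  cstar_pos (r%:C%C%:A - star a * a) -> cnorm a ^+ 2 <= r.
Proof.
move=> r0 ra; rewrite -cnorm_star.
have sa : star (star a * a) = star a * a by rewrite starM starK.
have sa' : star (a * star a) = a * star a by rewrite starM starK.
have ra' : cstar_pos (r%:C%C%:A - a * star a).
  split; first by rewrite starB starZr star1 sa'.
  (* Only nonzero spectral values pass from [a * star a] to [star a * a]; the value 0 corresponds to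
     [l = r], which is nonnegative by hypothesis. *)
  move=> l; have [/eqP|l0] := eqVneq (r%:C%C - l) 0.
    by rewrite subr_eq0 => /eqP <-; rewrite ge0_realC.
  move=> /spectrum_sub/(spectrum_mul_comm l0)/spectrum_sub; exact: ra.2.
(* Up to sign, twice the real and imaginary parts of [a]. *)
pose h := a + star a; pose k := 'i%C *: (a - star a).
have sh : star h = h by rewrite starD starK addrC.
have sk : star k = k by rewrite starZ starB starK conjc_i scaleNr -scalerN opprB.
have hk : h ^+ 2 + k ^+ 2 = (2 : R)%:C%C *: (star a * a + a * star a).
  rewrite !expr2 -scalerAl -scalerAr scalerA mulc_ii scaleN1r.
  rewrite rmorph_nat scaler_nat mulrBl !mulrBr !mulrDl !mulrDr.
  move: (a * a) (a * star a) (star a * a) (star a * star a) => p q s t.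
  rewrite opprB (opprB p) [s - t + _]addrC addrACA [p + q + _]addrC subrKA.
  by rewrite [s + t]addrC [t + s + _]addrC subrKA mulr2n [RHS]addrACA addrC.
have pp : cstar_pos (star a * a + a * star a).
  have -> : star a * a + a * star a = (2 : R)^-1%:C%C *: (h ^+ 2 + k ^+ 2).
    by rewrite hk scalerA -rmorphM mulVf// rmorph1 scale1r.
  apply: cstar_posZ; first by rewrite invr_ge0.
  by apply: cstar_posD; apply: cstar_pos_sqr.
have [al|al] := spectrum_radius sa.
  have /ra.2 : spectrum (r%:C%C%:A - star a * a) (r - cnorm (star a * a))%:C%C.
    by apply/spectrum_sub; rewrite -rmorphB subKr.
  by rewrite ge0_realC subr_ge0.
(* [r + star a * a] is the sum of [r - a * star a] and [star a * a + a * star a]. *)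
have /= pa : cstar_pos (r%:C%C%:A + star a * a).
  by have := cstar_posD ra' pp; rewrite [star a * a + _]addrC subrKA.
have /pa.2 : spectrum (r%:C%C%:A + star a * a) (r - cnorm (star a * a))%:C%C.
  by apply/spectrum_shift; rewrite -rmorphB addrAC subrr sub0r.
by rewrite ge0_realC subr_ge0.
Qed.

End CStar.

(** * Inner product and norm of a Hilbert module *)

Section Hilbert.
Context {R : realType} {A : cstarAlgType R} {H : hilbertModType A}.
Implicit Types (x y z : H) (a b : A) (r : R).

Local Notation "r %:A" := ((r%:C%C)%:A : A) : ring_scope.

Lemma innerDr x y z : inner x (y + z) = inner x y + inner x z.
Proof. by rewrite inner_star innerDl starD -!inner_star. Qed.

Lemma innerZr a x y : inner x (a *: y) = inner x y * star a.
Proof. by rewrite inner_star innerZl starM -inner_star. Qed.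

Lemma innerNl x y : inner (- x) y = - inner x y.
Proof. by rewrite -scaleN1r innerZl mulN1r. Qed.

Lemma innerNr x y : inner x (- y) = - inner x y.
Proof. by rewrite inner_star innerNl starN -inner_star. Qed.

Lemma innerBl x y z : inner (x - y) z = inner x z - inner y z.
Proof. by rewrite innerDl innerNl. Qed.

Lemma innerBr x y z : inner x (y - z) = inner x y - inner x z.
Proof. by rewrite innerDr innerNr. Qed.

Lemma inner0l y : inner (0 : H) y = 0.
Proof. by rewrite -(subrr y) innerBl subrr. Qed.

Lemma innerZCl r x y : inner (r%:A *: x) y = r%:C%C *: inner x y.
Proof. by rewrite innerZl -scalerAl mul1r. Qed.

Lemma innerZCr r x y : inner x (r%:A *: y) = r%:C%C *: inner x y.
Proof. by rewrite innerZr starZr star1 -scalerAr mulr1. Qed.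

Definition innerZC := (innerZCl, innerZCr).

Lemma inner_suml (I : Type) (s : seq I) (F : I -> H) y :
  inner (\sum_(i <- s) F i) y = \sum_(i <- s) inner (F i) y.
Proof.
by apply: (big_morph (fun x => inner x y)) => [u v|]; rewrite ?innerDl ?inner0l.
Qed.

Lemma inner_sumr (I : Type) (s : seq I) (F : I -> H) x :
  inner x (\sum_(i <- s) F i) = \sum_(i <- s) inner x (F i).
Proof.
rewrite inner_star inner_suml star_sum; apply: eq_bigr => i _.
by rewrite -inner_star.
Qed.

Lemma scaleC_comm r a x : r%:A *: (a *: x) = a *: (r%:A *: x).
Proof. by rewrite !scalerA -scalerAl -scalerAr mul1r mulr1. Qed.

Lemma scaleCM (r s : R) x : r%:A *: (s%:A *: x) = (r * s)%:A *: x.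
Proof. by rewrite scalerA -scalerAl mul1r scalerA -rmorphM. Qed.

Lemma scaleC1 x : 1%:A *: x = x.
Proof. by rewrite rmorph1 !scale1r. Qed.

Lemma hnorm_sqr x : hnorm x ^+ 2 = cnorm (inner x x).
Proof. by rewrite sqr_sqrtr ?cnorm_ge0. Qed.

Lemma hnorm_ge0 x : 0 <= hnorm x.
Proof. exact: sqrtr_ge0. Qed.

Lemma hnorm_eq0 x : hnorm x = 0 -> x = 0.
Proof.
by move=> x0; apply/inner_eq0/cnorm_eq0; rewrite -hnorm_sqr x0 expr0n.
Qed.

Lemma hnorm0 : hnorm (0 : H) = 0.
Proof. by rewrite /hnorm inner0l cnorm0 sqrtr0. Qed.

Lemma hnormN x : hnorm (- x) = hnorm x.
Proof. by rewrite /hnorm innerNl innerNr opprK. Qed.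

Lemma hnormZ a x : hnorm (a *: x) <= cnorm a * hnorm x.
Proof.
rewrite -(@ler_pXn2r _ 2) ?nnegrE ?mulr_ge0 ?hnorm_ge0 ?cnorm_ge0//.
rewrite exprMn !hnorm_sqr innerZl innerZr mulrA.
apply: le_trans (cnormM _ _) _; rewrite cnorm_starE expr2 mulrC -mulrA.
by rewrite ler_wpM2l ?cnorm_ge0 ?cnormM.
Qed.

Lemma hnormZC r x : hnorm (r%:A *: x) <= `|r| * hnorm x.
Proof. by apply: le_trans (hnormZ _ _) _; rewrite cnormZr cnorm1 mulr1. Qed.

(* Positivity of the square of [<x, x> y - <y, x> x], with the coefficient
   <x, x> replaced by its norm. *)
Lemma cauchy_schwarz x y : cnorm (inner x y) <= hnorm x * hnorm y.
Proof.
have [->|x0] := eqVneq x 0; first by rewrite inner0l cnorm0 hnorm0 mul0r.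
set d := inner x y; set X := cnorm (inner x x).
have X0 : 0 < X.
  rewrite lt_neqAle cnorm_ge0 eq_sym andbT; apply: contra x0 => /eqP h.
  exact/eqP/inner_eq0/cnorm_eq0.
pose u := (X ^+ 2)%:C%C *: inner y y + star d * inner x x * d.
have su : star u = u.
  rewrite starD starZr !starM starK -(inner_star y y) -(inner_star x x).
  by rewrite mulrA.
have pu : cstar_pos (u - (2 * X)%:C%C *: (star d * d)).
  have := inner_pos (X%:A *: y - star d *: x); congr cstar_pos.
  rewrite !innerBl !innerBr !innerZC !innerZl !innerZr !starK.
  rewrite -/d -[inner y x]starK -inner_star -/d.
  rewrite scalerA -rmorphM -expr2 mulrA opprB addrACA -opprD.
  by rewrite [2 * X]mulr_natl mulr2n rmorphD scalerDl.
have pn : cstar_pos ((cnorm u / (2 * X))%:A - star d * d).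
  have := cstar_posD (cstar_pos_cnorm su) pu; rewrite subrKA => p.
  have e : 0 <= (2 * X)^-1 by rewrite invr_ge0 mulr_ge0// ltW.
  have := cstar_posZ e p; congr cstar_pos.
  rewrite scalerBr !scalerA -!rmorphM [_ * cnorm u]mulrC mulVf ?rmorph1 ?scale1r//.
  by rewrite mulf_neq0// gt_eqF.
have e0 : 0 <= cnorm u / (2 * X).
  by rewrite divr_ge0 ?cnorm_ge0// mulr_ge0// ltW.
rewrite -(@ler_pXn2r _ 2) ?nnegrE ?mulr_ge0 ?hnorm_ge0 ?cnorm_ge0//.
rewrite exprMn !hnorm_sqr -/X.
have := star_mul_le_scalar e0 pn; rewrite ler_pdivlMr ?mulr_gt0//.
(* Together with [2 X ||d||^2 <= ||u||], the term [X ||d||^2] is absorbed on the left and a factor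
   [X] cancels. *)
have : cnorm u <= X ^+ 2 * cnorm (inner y y) + cnorm d ^+ 2 * X.
  apply: le_trans (cnormD _ _) _; rewrite cnormZr ger0_norm ?sqr_ge0// lerD2l.
  apply: le_trans (cnormM _ _) _; rewrite expr2 [leRHS]mulrAC ler_wpM2r ?cnorm_ge0//.
  by apply: le_trans (cnormM _ _) _; rewrite cnorm_starE.
move: (cnorm u) (cnorm d ^+ 2) (cnorm (inner y y)) => p q r h1 h2.
rewrite -(ler_pM2l X0); nra.
Qed.

Lemma hnormD x y : hnorm (x + y) <= hnorm x + hnorm y.
Proof.
rewrite -(@ler_pXn2r _ 2) ?nnegrE ?addr_ge0 ?hnorm_ge0//.
rewrite hnorm_sqr innerDl !innerDr.
have := cnormD (inner x x + inner x y) (inner y x + inner y y).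
have := cnormD (inner x x) (inner x y); have := cnormD (inner y x) (inner y y).
have := cauchy_schwarz x y; have := cauchy_schwarz y x.
rewrite -!hnorm_sqr sqrrD mulr2n [hnorm y * _]mulrC.
move: (cnorm _) (cnorm _) (cnorm _) (cnorm _) (cnorm _) (hnorm x) (hnorm y).
by move=> c1 c2 c3 c4 c5 p q; lra.
Qed.

Lemma hnorm_limit_unique (u : nat -> H) (l l' : H) :
  norm_cvg hnorm u l -> norm_cvg hnorm u l' -> l = l'.
Proof. exact: (norm_limit_unique hnormD hnormN hnorm0 hnorm_eq0). Qed.

End Hilbert.

Definition linear_map {A : pzRingType} {H : lmodType A} (g : H -> H)
    (gl : linear g) : {linear H -> H} :=
  HB.pack g (GRing.isLinear.Build A H H *:%R g gl).

(** * The frame operator, its inverse and the canonical dual *)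

Section FrameOperator.
Context {R : realType} {A : cstarAlgType R} {H : hilbertModType A}.
Variables (f : nat -> H) (S : H -> H).
Hypothesis fS : is_frame_operator f S.

Local Notation "r %:A" := ((r%:C%C)%:A : A) : ring_scope.

Lemma cvg_frame_series x y :
  norm_cvg cnorm
    (series (fun k => inner x (f k) * inner (f k) y)) (inner (S x) y).
Proof.
have -> : series (fun k => inner x (f k) * inner (f k) y) =
    (inner^~ y) \o series (fun k => inner x (f k) *: f k).
  apply/funext => n; rewrite /series /= inner_suml.
  by apply: eq_bigr => k _; rewrite innerZl.
apply: (@norm_cvg_map _ _ _ hnorm _ _ (hnorm y)) (fS x) => [a|z].
  exact: cnorm_ge0.
by rewrite -innerBl mulrC cauchy_schwarz.
Qed.

(** Both sides are limits of one scalar series, as the inner product is continuous in each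
    variable. *)
Lemma frame_operator_sym x y : inner (S x) y = inner x (S y).
Proof.
apply: (norm_limit_unique cnormD cnormN cnorm0 cnorm_eq0 (cvg_frame_series x y)).
have -> : series (fun k => inner x (f k) * inner (f k) y) =
    inner x \o series (fun k => inner y (f k) *: f k).
  apply/funext => n; rewrite /series /= inner_sumr.
  by apply: eq_bigr => k _; rewrite innerZr -inner_star.
apply: (@norm_cvg_map _ _ _ hnorm _ _ (hnorm x)) (fS y) => [a|z].
  exact: cnorm_ge0.
by rewrite -innerBr cauchy_schwarz.
Qed.

(** Symmetry suffices: the defect [w] has [inner w w = 0] once [S] is moved to the second
    argument. *)
Lemma frame_operator_linear : linear S.
Proof.
move=> a x y; apply/subr0_eq/inner_eq0; set w : H := (X in inner X _).
rewrite {1}/w innerBl innerDl innerZl !frame_operator_sym.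
by rewrite innerDl innerZl subrr.
Qed.

Lemma frame_operatorB x y : S (x - y) = S x - S y.
Proof. exact: (raddfB (linear_map frame_operator_linear)). Qed.

Lemma frame_operatorZ (a : A) x : S (a *: x) = a *: S x.
Proof. exact: (linearZ_LR (linear_map frame_operator_linear)). Qed.

Lemma frame_operator_bounds : is_frame f -> exists a b : R, [/\ 0 < a, a < b,
  forall x, cstar_le (a%:C%C *: inner x x) (inner (S x) x) &
  forall x, cstar_le (inner (S x) x) (b%:C%C *: inner x x)].
Proof.
(* The upper bound is enlarged to [a + b] to force [a < b], which fails for equal bounds and may
   fail otherwise when [H] is zero. *)
move=> [a [b [a0 b0 fr]]]; exists a, (a + b); split=> // [|x|x].
- by lra.
- have [s [sx ax _]] := fr x; congr cstar_le: ax.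
  exact: (norm_limit_unique cnormD cnormN cnorm0 cnorm_eq0 sx (cvg_frame_series x x)).
- have [s [sx _ bx]] := fr x.
  rewrite -(norm_limit_unique cnormD cnormN cnorm0 cnorm_eq0 sx (cvg_frame_series x x)).
  rewrite /cstar_le rmorphD scalerDl -addrA.
  by apply: cstar_posD bx; apply: cstar_posZ (ltW a0) (inner_pos x).
Qed.

Variables a b : R.
Hypotheses (a0 : 0 < a) (ab : a < b)
  (lower : forall x, cstar_le (a%:C%C *: inner x x) (inner (S x) x))
  (upper : forall x, cstar_le (inner (S x) x) (b%:C%C *: inner x x)).

Let b0 : 0 < b. Proof. exact: lt_trans ab. Qed.

Lemma frame_operator_pos x : cstar_pos (inner (S x) x).
Proof.
rewrite -(subrK (a%:C%C *: inner x x) (inner _ _)).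
by apply: cstar_posD (lower x) _; apply: cstar_posZ (ltW a0) (inner_pos x).
Qed.

(** The difference is [<Sx - ax, Sx - ax> + a (<Sx, x> - a <x, x>)]. *)
Lemma frame_operator_sqr_ge x :
  cstar_le (a%:C%C *: inner (S x) x) (inner (S x) (S x)).
Proof.
have p := inner_pos (S x - a%:A *: x).
have := cstar_posD p (cstar_posZ (ltW a0) (lower x)); congr cstar_pos.
rewrite !innerBl !innerBr !innerZC -[inner x (S x)]frame_operator_sym scalerBr.
by rewrite subrK.
Qed.

(** [b] times the difference is [<S(bx - Sx), bx - Sx> + (b <Sx, Sx> - <SSx, Sx>)]. *)
Lemma frame_operator_sqr_le x :
  cstar_le (inner (S x) (S x)) (b%:C%C *: inner (S x) x).
Proof.
have p := frame_operator_pos (b%:A *: x - S x).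
have {}p := cstar_posD p (upper (S x)).
have bV : 0 <= b^-1 by rewrite invr_ge0 ltW.
have := cstar_posZ bV p; congr cstar_pos.
rewrite frame_operatorB frame_operatorZ.
rewrite !innerBl !innerBr !innerZC (frame_operator_sym (S x) x).
rewrite subrK -scalerBr scalerA -rmorphM mulVf ?gt_eqF//.
by rewrite rmorph1 scale1r.
Qed.

(** Cauchy-Schwarz: [a ||x||^2 <= ||<Sx, x>|| <= ||Sx|| ||x||]. *)
Lemma frame_operator_bound_below x : a * hnorm x <= hnorm (S x).
Proof.
have [->|x0] := eqVneq (hnorm x) 0; first by rewrite mulr0 hnorm_ge0.
have xp : 0 < hnorm x by rewrite lt_neqAle eq_sym x0 hnorm_ge0.
rewrite -(ler_pM2r xp); apply: le_trans (cauchy_schwarz _ _).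
have p : cstar_pos (a%:C%C *: inner x x) by apply: cstar_posZ (ltW a0) (inner_pos x).
have := cstar_le_cnorm p (lower x).
by rewrite cnormZr gtr0_norm// -hnorm_sqr expr2 mulrA.
Qed.

Lemma frame_operator_inj : injective S.
Proof.
move=> x y xy; apply/subr0_eq/hnorm_eq0/eqP; rewrite eq_le hnorm_ge0 andbT.
rewrite -(ler_pM2l a0) mulr0; apply: le_trans (frame_operator_bound_below _) _.
by rewrite frame_operatorB xy subrr hnorm0.
Qed.

Lemma frame_operator_surj y : exists x, S x = y.
Proof.
pose phi (x : H) := x - (b^-1)%:A *: S x.
(* From [||bx - Sx||^2 <= b (b - a) ||x||^2], as [<Sx, Sx> <= b <Sx, x>] and
   [<Sx, x> >= a <x, x>]. *)
pose q := b^-1 * Num.sqrt (b * (b - a)).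
have q1 : q < 1.
  rewrite /q mulrC ltr_pdivrMr// mul1r -[X in _ < X](ger0_norm (ltW b0)) -sqrtr_sqr.
  by rewrite ltr_sqrt ?exprn_gt0// expr2 ltr_pM2l// ltrBlDr ltrDl.
have phiq x : hnorm (phi x) <= q * hnorm x.
  have -> : phi x = (b^-1)%:A *: (b%:A *: x - S x).
    by rewrite scalerBr scaleCM mulVf ?gt_eqF// scaleC1.
  apply: le_trans (hnormZC _ _) _; rewrite gtr0_norm ?invr_gt0// -mulrA.
  rewrite ler_pM2l ?invr_gt0// /hnorm -sqrtrM; last first.
    by rewrite mulr_ge0// ?subr_ge0 ltW.
  have e : 0 <= b * (b - a) by rewrite mulr_ge0// ?subr_ge0 ltW.
  apply: ler_wsqrtr; rewrite -[b * (b - a)]ger0_norm// -cnormZr.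
  apply: cstar_le_cnorm; first exact: inner_pos.
  have p := cstar_posD (frame_operator_sqr_le x) (cstar_posZ (ltW b0) (lower x)).
  move: p; congr cstar_pos.
  rewrite !innerBl !innerBr !innerZC -frame_operator_sym.
  rewrite -[inner x (S x)]frame_operator_sym.
  rewrite mulrBr rmorphB !rmorphM scalerBl -!scalerA scalerBr.
  by rewrite opprB opprB [RHS]addrC -[RHS]addrA subrKA.
have phiB : {morph phi : u v / u - v}.
  by move=> u v; rewrite /phi frame_operatorB scalerBr opprD addrACA -opprD.
have [x hx] := contraction_subr_surj hnormD hnormN hnorm0 hnorm_eq0
  ((b^-1)%:A *: y) inner_complete phiB q1 phiq.
exists x; rewrite -[LHS]scaleC1 -[RHS]scaleC1 -(mulfV (negbT (gt_eqF b0))).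
by rewrite -!scaleCM -hx /phi subKr.
Qed.

Lemma op_invK : cancel (op_inv S) S.
Proof.
move=> y; apply: surjpK; last by rewrite inE.
by move=> x _; have [z <-] := frame_operator_surj x; exists z.
Qed.

Lemma op_invKl : cancel S (op_inv S).
Proof. by move=> x; apply: frame_operator_inj; rewrite op_invK. Qed.

Lemma op_inv_linear : linear (op_inv S).
Proof.
move=> c x y; apply: frame_operator_inj.
by rewrite frame_operator_linear !op_invK.
Qed.

Lemma op_inv_bounded x : hnorm (op_inv S x) <= a^-1 * hnorm x.
Proof.
rewrite ler_pdivlMl//.
by rewrite -{2}(op_invK x) frame_operator_bound_below.
Qed.

Lemma op_inv_sym x y : inner (op_inv S x) y = inner x (op_inv S y).
Proof. by rewrite -{1}(op_invK y) -frame_operator_sym op_invK. Qed.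

(** The dual series at [x] is the frame series at [z = S^-1 x], with sum [<z, x>]; the bounds are
    [a <Sz, z> <= <Sz, Sz> <= b <Sz, z>], divided by [a] and [b]. *)
Lemma is_frame_canonical_dual : is_frame (canonical_dual S f).
Proof.
exists b^-1, a^-1; split; rewrite ?invr_gt0// => x; exists (inner (op_inv S x) x).
split.
- have := cvg_frame_series (op_inv S x) (op_inv S x).
  rewrite op_invK -op_inv_sym; congr norm_cvg.
  apply/funext => n; apply: eq_bigr => k _.
  by rewrite /canonical_dual op_inv_sym -(op_inv_sym (f k)).
- have bV : 0 <= b^-1 by rewrite invr_ge0 ltW.
  have := cstar_posZ bV (frame_operator_sqr_le (op_inv S x)); congr cstar_pos.
  rewrite op_invK scalerBr scalerA -rmorphM mulVf ?gt_eqF// rmorph1 scale1r.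
  by rewrite op_inv_sym.
- have aV : 0 <= a^-1 by rewrite invr_ge0 ltW.
  have := cstar_posZ aV (frame_operator_sqr_ge (op_inv S x)); congr cstar_pos.
  rewrite op_invK scalerBr scalerA -rmorphM mulVf ?gt_eqF// rmorph1 scale1r.
  by rewrite op_inv_sym.
Qed.

(** The dual series at [x] is the image under [S^-1] of the frame series at [S^-1 x], which
    converges to [x]. *)
Lemma canonical_dual_operator :
  is_frame_operator (canonical_dual S f) (op_inv S).
Proof.
move=> x.
have -> : series (fun k => inner x (canonical_dual S f k) *: canonical_dual S f k) =
    op_inv S \o series (fun k => inner (op_inv S x) (f k) *: f k).
  apply/funext => n; rewrite /series /=.
  rewrite -[RHS]/(linear_map op_inv_linear _) raddf_sum.
  by apply: eq_bigr => k _; rewrite [RHS](linearZ_LR (linear_map _)) op_inv_sym.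
rewrite -{2}(op_invK x).
apply: (@norm_cvg_map _ _ _ hnorm _ _ a^-1) (fS _) => [y|y]; first exact: hnorm_ge0.
rewrite -[_ - _](raddfB (linear_map op_inv_linear)); exact: op_inv_bounded.
Qed.

End FrameOperator.

(** * Compact operators *)

Section Compact.
Context {R : realType} {A : cstarAlgType R} {H : hilbertModType A}.

(** [B] sends [rank_one x y] to [rank_one x (B y)], so approximating [K] within [e / c] suffices. A
    separate [L], equal to the composite pointwise, allows the identity to be treated this way. *)
Lemma compact_operator_comp (K L B : {linear H -> H}) (c : R) :
    0 < c -> (forall x, hnorm (B x) <= c * hnorm x) ->
    compact_operator K -> (forall x, L x = B (K x)) ->
  compact_operator L.
Proof.
move=> c0 Bc cK LBK e e0; have ec : 0 < c^-1 * e by rewrite mulr_gt0 ?invr_gt0.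
have [F [n [l [x [y FE]]]] KF] := cK _ ec; exists (B \o F).
  exists n, l, x, (B \o y) => z; rewrite /= FE raddf_sum.
  by apply: eq_bigr => i _; rewrite /rank_one /= !linearZ_LR.
move=> z; rewrite LBK /= -raddfB; apply: le_trans (Bc _) _.
by rewrite -ler_pdivlMl// mulrA.
Qed.

End Compact.

(** * Compact-tightness of the canonical dual *)

Theorem theorem3p7 (R : realType) (A : cstarAlgType R) (H : hilbertModType A)
    (f : nat -> H) (S : H -> H) :
  countably_generated H ->
  compact_tight_frame f ->
  is_frame_operator f S ->
  compact_tight_frame (canonical_dual S f).
Proof.
move=> _ [ff [S0 [fS0 [K [xi [cK S0E]]]]]] fS.
(* The operator witnessing compact-tightness is [S], by uniqueness of limits. *)
have SE x : S x = K x + (xi%:C%C%:A : A) *: x.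
  by rewrite -S0E; apply: hnorm_limit_unique (fS x) (fS0 x).
have [a [b [a0 ab lower upper]]] := frame_operator_bounds fS ff.
have KT := op_invKl fS a0 ab lower upper.
pose T : {linear H -> H} := linear_map (op_inv_linear fS a0 ab lower upper).
have Ta x : hnorm (T x) <= a^-1 * hnorm x.
  exact: (op_inv_bounded fS a0 ab lower upper).
have aV : 0 < a^-1 by rewrite invr_gt0.
split; first exact: (is_frame_canonical_dual fS a0 ab lower upper).
exists T; split; first exact: (canonical_dual_operator fS a0 ab lower upper).
have TSE x : x = T (K x) + (xi%:C%C%:A : A) *: T x.
  by rewrite -linearZ_LR -raddfD -SE /= KT.
have [xi0|xi0] := eqVneq xi 0.
  have id_compact : compact_operator (idfun : {linear H -> H}).
    apply: (compact_operator_comp aV Ta cK) => x.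
    by rewrite {1}[x]TSE xi0 rmorph0 !scale0r addr0.
  exists T, 0; split; first exact: (compact_operator_comp aV Ta id_compact).
  by move=> x; rewrite rmorph0 !scale0r addr0.
pose B x : H := ((- xi^-1)%:C%C%:A : A) *: T x.
(* Real scalars are central in [A], so scaling by one preserves linearity over [A]. *)
have Bl : linear B.
  by move=> c x y; rewrite /B linearP scalerDr scaleC_comm.
have Bb x : hnorm (linear_map Bl x) <= (`|- xi^-1| * a^-1) * hnorm x.
  apply: le_trans (hnormZC _ _) _; rewrite -mulrA.
  by rewrite ler_wpM2l// Ta.
pose L : {linear H -> H} := linear_map Bl \o K.
exists L, xi^-1; split.
  apply: (compact_operator_comp _ Bb cK) => //.
  by rewrite mulr_gt0// normr_gt0 oppr_eq0 invr_eq0.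
(* In [xi^-1 x = xi^-1 T K x + T x] the first term cancels [L x]. *)
move=> x; rewrite {3}[x]TSE scalerDr scaleCM mulVf// scaleC1 addrA.
by rewrite /L /= /B rmorphN !scaleNr addNr add0r.
Qed.
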